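(* Solving (P1$_n$) is equivalent to solving (P2$_n$) (both problems are defined in the context) in the following sense: 1. For any feasible solution $(\tilde u,\tilde v)$ of (P2$_n$), let $\tilde y:=\tilde u-\tilde v$. Then $\tilde y$ is feasible for (P1$_n$). 2. For any feasible solution $\tilde y$ of (P1$_n$), there exists a feasible point $(\tilde u,\tilde v)$ of (P2$_n$). 3. Assume that the point $(\tilde u^\star,\tilde v^\star)$ is an optimizer of (P2$_n$). Then by letting $\tilde y^\star:=\tilde u^\star-\tilde v^\star$, the point $\tilde y^\star$ is also an optimizer of (P1$_n$), with the same optimal value.
   Context: Let $f:\mathbb R^d\times\mathbb R^m\to\mathbb R$, a decision $x\in\mathbb R^d$, data points $\xi_1,\dots,\xi_n\in\mathbb R^m$ and a radius $\epsilon(\beta_n)>0$ be given. $\|\cdot\|$ denotes the 1-norm. Put $h_k(y):=f(x,\xi_k-y)$ for $y\in\mathbb R^m$, $k=1,\dots,n$. (P1$_n$): $\sup_{y}\ \frac1n\sum_{k=1}^nf(x,\xi_k-y_k)$ subject to $\frac1n\sum_{k=1}^n\|y_k\|\le\epsilon(\beta_n)$, where $y=(y_1,\dots,y_n)$ with $y_k\in\mathbb R^m$. (P2$_n$): $\max_{u,v}\ \frac1n\sum_{k=1}^nh_k(u_k-v_k)$ subject to $(u,v)\in n\epsilon(\beta_n)\Delta_{2mn}$, where $u=(u_1,\dots,u_n)$, $v=(v_1,\dots,v_n)$, $u_k,v_k\in\mathbb R^m$, and $\Delta_{2mn}=\{(u,v)\in\mathbb R^{2mn}: \text{all entries}\ge0\text{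 and the entries sum to }1\}$. *)

(* Defs.v *)
From mathcomp Require Import all_boot all_order all_algebra.
From mathcomp Require Import all_classical all_reals all_analysis.

Set Implicit Arguments.
Unset Strict Implicit.
Unset Printing Implicit Defensive.

Import Order.TTheory GRing.Theory Num.Theory.

Local Open Scope classical_set_scope.
Local Open Scope ring_scope.

Record maxProblem (R : realType) (T : Type) := MaxProblem {
  objective : T -> R;
  feasible : set T
}.

Definition optimizer (R : realType) (T : Type) (P : maxProblem R T) (z : T) :
    Prop :=
  feasible P z /\ forall w, feasible P w -> objective P w <= objective P z.

(* Extended-real valued, because the objective need not be bounded above on
   the feasible set. *)
Definition optimal_value (R : realType) (T : Type) (P : maxProblem R T) :
    \bar R :=
  ereal_sup [set (objective P z)%:E | z in feasible P].

(* The norm `|v| that the library puts on row vectors is the max norm. *)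
Definition norm1 (R : realType) (m : nat) (v : 'rV[R]_m) : R :=
  \sum_(j < m) `|v 0 j|.

(* A family (y_1, ..., y_n) of vectors of R^m is the n x m matrix whose k-th
   row is y_k; a point (u, v) of R^(2mn) is a pair of such matrices. *)
Definition simplex (R : realType) (n m : nat) :
    set ('M[R]_(n, m) * 'M[R]_(n, m)) :=
  [set w : 'M[R]_(n, m) * 'M[R]_(n, m) |
     (forall k j, 0 <= w.1 k j /\ 0 <= w.2 k j) /\
     \sum_(k < n) \sum_(j < m) w.1 k j + \sum_(k < n) \sum_(j < m) w.2 k j = 1].

Definition P1 (R : realType) (d m n : nat) (f : 'rV[R]_d * 'rV[R]_m -> R)
    (x : 'rV[R]_d) (xi : 'I_n -> 'rV[R]_m) (eps : R) :
    maxProblem R 'M[R]_(n, m) :=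
  MaxProblem
    (fun y => n%:R^-1 * \sum_(k < n) f (x, xi k - row k y))
    [set y | n%:R^-1 * \sum_(k < n) norm1 (row k y) <= eps].

Definition h (R : realType) (d m n : nat) (f : 'rV[R]_d * 'rV[R]_m -> R)
    (x : 'rV[R]_d) (xi : 'I_n -> 'rV[R]_m) (k : 'I_n) (y : 'rV[R]_m) : R :=
  f (x, xi k - y).

Definition P2 (R : realType) (d m n : nat) (f : 'rV[R]_d * 'rV[R]_m -> R)
    (x : 'rV[R]_d) (xi : 'I_n -> 'rV[R]_m) (eps : R) :
    maxProblem R ('M[R]_(n, m) * 'M[R]_(n, m)) :=
  MaxProblem
    (fun w => n%:R^-1 * \sum_(k < n) h f x xi k (row k w.1 - row k w.2))
    [set (n%:R * eps) *: w | w in @simplex R n m].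

(* Main.v *)
Require Import Defs.
From mathcomp Require Import all_boot all_order all_algebra.
From mathcomp Require Import all_classical all_reals all_analysis.
From mathcomp Require Import ring lra.

Set Implicit Arguments.
Unset Strict Implicit.
Unset Printing Implicit Defensive.

Import Order.TTheory GRing.Theory Num.Theory.

Local Open Scope classical_set_scope.
Local Open Scope ring_scope.

(** Clearing the factor [n%:R^-1] measures feasibility against the budget [n%:R * eps], the same one
    as in (P2). *)
Lemma feasible_P1E (R : realType) (d m n : nat)
    (f : 'rV[R]_d * 'rV[R]_m -> R) (x : 'rV[R]_d) (xi : 'I_n -> 'rV[R]_m)
    (eps : R) (y : 'M[R]_(n, m)) : (0 < n)%N ->
  feasible (P1 f x xi eps) y <->
  \sum_(k < n) \sum_(j < m) `|y k j| <= n%:R * eps.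
Proof.
move=> n_gt0; rewrite /= ler_pdivrMl ?ltr0n //.
by under eq_bigr do rewrite /norm1; under eq_bigr do under eq_bigr do rewrite mxE.
Qed.

(** Since [n%:R * eps] is positive, scaling by it is invertible and preserves signs, so membership
    in the scaled simplex can be tested on [(u, v)] directly, without a preimage. *)
Lemma feasible_P2E (R : realType) (d m n : nat)
    (f : 'rV[R]_d * 'rV[R]_m -> R) (x : 'rV[R]_d) (xi : 'I_n -> 'rV[R]_m)
    (eps : R) (u v : 'M[R]_(n, m)) : (0 < n)%N -> 0 < eps ->
  feasible (P2 f x xi eps) (u, v) <->
  (forall k j, 0 <= u k j /\ 0 <= v k j) /\
  \sum_(k < n) \sum_(j < m) (u k j + v k j) = n%:R * eps.
Proof.
move=> n_gt0 eps_gt0; have c_gt0 : 0 < n%:R * eps by rewrite mulr_gt0 ?ltr0n.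
set c := n%:R * eps in c_gt0 *.
have scaleE (a : R) (p q : 'M[R]_(n, m)) :
    \sum_(k < n) \sum_(j < m) ((a *: p) k j + (a *: q) k j) =
    a * (\sum_(k < n) \sum_(j < m) p k j + \sum_(k < n) \sum_(j < m) q k j).
  rewrite -big_split mulr_sumr; apply: eq_bigr => k _.
  rewrite -big_split mulr_sumr; apply: eq_bigr => j _.
  by rewrite !mxE mulrDr.
split=> /= [[[p q] [/= pq_ge0 sum1] [<- <-]]|[uv_ge0 sumc]].
  split=> [k j|]; last by rewrite scaleE sum1 mulr1.
  by rewrite !mxE; have [? ?] := pq_ge0 k j; split; rewrite mulr_ge0 // ltW.
exists (c^-1 *: u, c^-1 *: v); last first.
  by congr pair; rewrite /= scalerA divff ?gt_eqF // scale1r.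
split=> /= [k j|].
  by rewrite !mxE; have [? ?] := uv_ge0 k j; split; rewrite mulr_ge0 // invr_ge0 ltW.
(* The factor [c^-1 * c] is inserted so that [scaleE] can absorb [c] into the sum; there it cancels
   the scaling of [u] and [v], whose total is [c]. *)
rewrite -[LHS]mul1r -(mulVf (lt0r_neq0 c_gt0)) -mulrA -scaleE.
by rewrite !scalerA divff ?gt_eqF // !scale1r sumc mulVf ?gt_eqF.
Qed.

Lemma objective_P2E (R : realType) (d m n : nat)
    (f : 'rV[R]_d * 'rV[R]_m -> R) (x : 'rV[R]_d) (xi : 'I_n -> 'rV[R]_m)
    (eps : R) (u v : 'M[R]_(n, m)) :
  objective (P2 f x xi eps) (u, v) = objective (P1 f x xi eps) (u - v).
Proof. by rewrite /= /h; under [in RHS]eq_bigr do rewrite linearB. Qed.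

(** Entrywise triangle inequality: for nonnegative entries, [u k j + v k j] bounds the absolute
    value of the difference, and these bounds add up to exactly the budget. *)
Lemma feasible_P1_sub (R : realType) (d m n : nat)
    (f : 'rV[R]_d * 'rV[R]_m -> R) (x : 'rV[R]_d) (xi : 'I_n -> 'rV[R]_m)
    (eps : R) (u v : 'M[R]_(n, m)) : (0 < n)%N -> 0 < eps ->
  feasible (P2 f x xi eps) (u, v) -> feasible (P1 f x xi eps) (u - v).
Proof.
move=> n_gt0 eps_gt0 /(feasible_P2E _ _ _ _ _ n_gt0 eps_gt0)[uv_ge0 sumc].
apply/feasible_P1E => //; rewrite -sumc.
apply: ler_sum => k _; apply: ler_sum => j _; have [u_ge0 v_ge0] := uv_ge0 k j.
by rewrite !mxE (le_trans (ler_normB _ _)) // !ger0_norm.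
Qed.

(* [u] and [v] are the positive and negative parts of [y], both shifted by the
   constant [s] that uses up the rest of the budget [n * eps]: this changes
   neither the sign conditions nor [u - v]. *)
Lemma feasible_P1_split (R : realType) (d m n : nat)
    (f : 'rV[R]_d * 'rV[R]_m -> R) (x : 'rV[R]_d) (xi : 'I_n -> 'rV[R]_m)
    (eps : R) (y : 'M[R]_(n, m)) : (0 < m)%N -> (0 < n)%N -> 0 < eps ->
  feasible (P1 f x xi eps) y ->
  exists u v : 'M[R]_(n, m), feasible (P2 f x xi eps) (u, v) /\ u - v = y.
Proof.
move=> m_gt0 n_gt0 eps_gt0 /(feasible_P1E _ _ _ _ _ n_gt0).
set S := (X in X <= _) => S_le.
have m_neq0 : m%:R != 0 :> R by rewrite pnatr_eq0 -lt0n.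
have n_neq0 : n%:R != 0 :> R by rewrite pnatr_eq0 -lt0n.
(* The slack left by the total 1-norm [S] of [y] is shared equally among the [2 * n * m] entries of
   [u] and [v]. *)
pose s : R := (n%:R * eps - S) / (2 * (n%:R * m%:R)).
have s_ge0 : 0 <= s by rewrite divr_ge0 ?subr_ge0 // !mulr_ge0.
exists (\matrix_(k, j) ((`|y k j| + y k j) / 2 + s)).
exists (\matrix_(k, j) ((`|y k j| - y k j) / 2 + s)).
split; last by apply/matrixP => k j; rewrite !mxE; field.
apply/feasible_P2E => //; split=> [k j|].
  rewrite !mxE; have := ler_norm (y k j); have := ler_norm (- y k j).
  by rewrite normrN => ? ?; split; lra.
(* The two parts of an entry add up to its absolute value, and the shifts contribute [2 * s] at each
   of the [n * m] positions, hence [n%:R * eps - S] in all. *)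
transitivity (\sum_(k < n) \sum_(j < m) (`|y k j| + 2 * s)).
  by apply: eq_bigr => k _; apply: eq_bigr => j _; rewrite !mxE; field.
under eq_bigr do rewrite big_split sumr_const card_ord /=.
rewrite big_split sumr_const card_ord /= -/S -mulrnA -[_ *+ (m * n)]mulr_natr natrM /s.
by field; rewrite m_neq0 n_neq0.
Qed.

Theorem mainTheorem2 (R : realType) (d m n : nat) (hm : (0 < m)%N)
    (hn : (0 < n)%N) (f : 'rV[R]_d * 'rV[R]_m -> R) (x : 'rV[R]_d)
    (xi : 'I_n -> 'rV[R]_m) (eps : R) (heps : 0 < eps) :
  [/\ forall u v : 'M[R]_(n, m),
        feasible (P2 f x xi eps) (u, v) -> feasible (P1 f x xi eps) (u - v),
      forall y : 'M[R]_(n, m),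
        feasible (P1 f x xi eps) y ->
        exists u v : 'M[R]_(n, m),
          feasible (P2 f x xi eps) (u, v) /\ u - v = y
    & forall u v : 'M[R]_(n, m),
        optimizer (P2 f x xi eps) (u, v) ->
        optimizer (P1 f x xi eps) (u - v) /\
        optimal_value (P1 f x xi eps) = optimal_value (P2 f x xi eps) ].
Proof.
have sub u v := @feasible_P1_sub R d m n f x xi eps u v hn heps.
have split_y y := @feasible_P1_split R d m n f x xi eps y hm hn heps.
split=> // u v [uv_feas uv_opt]; split.
  (* Any competitor in (P1) is a difference [p - q] from a feasible pair with the same objective
     value, so optimality of [(u, v)] applies to it. *)
  split=> [|y /split_y[p [q [pq_feas <-]]]]; first exact: sub.
  by rewrite -!objective_P2E; exact: uv_opt.
(* Both suprema are taken over the same set of attained values: splitting [y] gives one inclusion,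
   subtraction the other. *)
congr ereal_sup; apply/seteqP; split.
  move=> _ [y /split_y[p [q [pq_feas <-]]] <-].
  by exists (p, q); rewrite ?objective_P2E.
by move=> _ [[p q] pq_feas <-]; exists (p - q); rewrite ?objective_P2E //; exact: sub.
Qed.
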